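(* Let $k,r,m$ be positive integers with $k\ne r$ and let $\alpha>\max\{k,r\}$ be real. Then each of the sums $$\sum_{n=1}^\infty\frac{H_{n+\alpha}^{(m)}}{(n+r)(n+k)},\quad \sum_{n=1}^\infty\frac{H_{n+\alpha}H_{n+\alpha}^{(2)}}{(n+r)(n+k)},\quad \sum_{n=1}^\infty\frac{H_{n+\alpha}^3}{(n+r)(n+k)},\quad \sum_{n=1}^\infty\frac{H_{n+\alpha}^2H_{n+\alpha}^{(2)}}{(n+r)(n+k)}$$ is equal to a finite sum of terms of the form $c(\alpha)\prod_{i}\zeta(s_i)\prod_{j}H^{(m_j)}_{\alpha+t_j}$, where $c$ is a rational function of $\alpha$ with rational coefficients (depending on $k,r,m$), the $s_i\ge2$ and $m_j\ge1$ are integers, and the $t_j$ are integers.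
   Context: Shifted harmonic numbers: for a real $\alpha$ that is not a negative integer, $H_\alpha := \sum_{k=1}^\infty\left(\frac1k-\frac1{k+\alpha}\right)$ and, for integers $m\ge 2$, $H_\alpha^{(m)} := \sum_{k=1}^\infty\left(\frac1{k^m}-\frac1{(k+\alpha)^m}\right)=\zeta(m)-\zeta(m,\alpha+1)$, where $\zeta$ is the Riemann zeta function and $\zeta(s,\alpha+1)=\sum_{n=1}^\infty (n+\alpha)^{-s}$ is the Hurwitz zeta function; $H_\alpha^{(1)}:=H_\alpha$. Powers such as $H_\alpha^2$ mean $(H_\alpha)^2$. *)

(* Defs.v *)
From Stdlib Require Import Reals Lra Lia List QArith Qreals ClassicalEpsilon.
Open Scope R_scope.

Definition Hm (m : nat) (x : R) : R :=
  epsilon (inhabits 0)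
    (fun l => infinite_sum
       (fun j => / (INR (S j)) ^ m - / (INR (S j) + x) ^ m) l).

Definition zeta (s : nat) : R :=
  epsilon (inhabits 0)
    (fun l => infinite_sum (fun j => / (INR (S j)) ^ s) l).

Definition peval (p : list Q) (x : R) : R :=
  fold_right (fun c acc => Q2R c + x * acc) 0 p.

Definition prodR (l : list R) : R := fold_right Rmult 1 l.

(* A term  c(a) * prod_i zeta(s_i) * prod_j H^{(m_j)}_{a + t_j},
   with c = num/den a rational function with rational coefficients. *)
Record term := mkTerm {
  t_num : list Q;
  t_den : list Q;
  t_zetas : list nat;
  t_harms : list (nat * Z)     (* the pairs (m_j, t_j) *)
}.

Definition term_valid (t : term) : Prop :=
  Forall (fun s => (2 <= s)%nat) (t_zetas t) /\
  Forall (fun p => (1 <= fst p)%nat) (t_harms t).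

Definition term_ok_at (a : R) (t : term) : Prop :=
  peval (t_den t) a <> 0 /\
  Forall (fun p => forall n : nat, a + IZR (snd p) <> - INR (S n)) (t_harms t).

Definition term_eval (a : R) (t : term) : R :=
  peval (t_num t) a / peval (t_den t) a
  * prodR (map zeta (t_zetas t))
  * prodR (map (fun p => Hm (fst p) (a + IZR (snd p))) (t_harms t)).

Definition representable (M : R) (f : R -> nat -> R) : Prop :=
  exists ts : list term,
    Forall term_valid ts /\
    forall a : R, a > M ->
      Forall (term_ok_at a) ts /\
      infinite_sum (fun n => f a (S n))
        (fold_right Rplus 0 (map (term_eval a) ts)).

(* Main.v *)
(** Since 1/((n+r)(n+k)) is a rational combination of the 1/((n+j)(n+j+1)) with j between
    r and k, and since the substitution b = a - j turns each resulting series into a tail,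
    summation by parts reduces the theorem to
    T_F(b) = sum_n (F(n+b) - F(n+b-1))/n for b > 0.
    Write H = H_b, H^(m) = H_b^(m) and h_m = zeta(m) - H^(m).
    Partial fractions give T for F = H^(m).
    The polynomials P_1 = H, P_2 = H^2 + H^(2), P_3 = H^3 + 3 H H^(2) + 2 H^(3)
    satisfy P_m(x) - P_m(x-1) = m P_{m-1}(x)/x and T_{P_m}(b) = m P_m(b)/b.
    The sums of h_2(n+b)/n and of (H h_2)(n+b)/n also have closed forms, namely
    H h_2 + h_3 and H^2 h_2 + H h_3 + zeta(2) h_2 - h_2^2/2 + h_4/2, because both sides obey
    the same difference equation in b and vanish at infinity.
    In T for H h_2 and H^2 h_2 the identity 1/(n x) = (1/n - 1/x)/b, x = n + b, leaves only
    these sums and telescoping ones.  Finally H H^(2), H^3 and H^2 H^(2) are linear combinations, with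
    coefficients in Q[zeta(2)], of H, H^(2), H^(3), P_2, P_3, H h_2 and H^2 h_2. *)

From Coquelicot Require Import Coquelicot.
Require Import Defs.
From Stdlib Require Import Reals Lra Lia List QArith Qreals ClassicalEpsilon.
Open Scope R_scope.

(** * Series and limits of real sequences *)

Lemma INR_S_pos (n : nat) : 0 < INR (S n).
Proof. apply lt_0_INR; lia. Qed.

Lemma sum_Sn_R (a : nat -> R) (n : nat) :
  @eq R (sum_n a (S n)) (sum_n a n + a (S n)).
Proof. exact (sum_Sn a n). Qed.

Lemma is_series_mono (a b : nat -> R) (la lb : R) :
  (forall n, a n <= b n) -> is_series a la -> is_series b lb -> la <= lb.
Proof.
  intros H Ha Hb.
  apply (is_lim_seq_le (sum_n a) (sum_n b) la lb); [|exact Ha|exact Hb].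
  intros n; apply sum_n_m_le; exact H.
Qed.

Lemma ex_series_nonneg_bounded (a : nat -> R) (B : R) :
  (forall n, 0 <= a n) -> (forall N, sum_n a N <= B) -> ex_series a.
Proof.
  intros Ha HB.
  destruct (ex_finite_lim_seq_incr (sum_n a) B) as [l Hl]; [|exact HB|exists l; exact Hl].
  intros n; rewrite sum_Sn_R; specialize (Ha (S n)); lra.
Qed.

Lemma ex_series_nonneg_le (a b : nat -> R) :
  (forall n, 0 <= a n <= b n) -> ex_series b -> ex_series a.
Proof.
  intros H; apply (ex_series_le (K := R_AbsRing) (V := R_CompleteNormedModule)).
  intros n; unfold norm; simpl; unfold abs; simpl.
  rewrite Rabs_pos_eq; apply H.
Qed.

Lemma is_series_Rplus (a b : nat -> R) (la lb : R) :
  is_series a la -> is_series b lb -> is_series (fun n => a n + b n) (la + lb).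
Proof. exact (is_series_plus a b la lb). Qed.

Lemma is_series_Rminus (a b : nat -> R) (la lb : R) :
  is_series a la -> is_series b lb -> is_series (fun n => a n - b n) (la - lb).
Proof. exact (is_series_minus a b la lb). Qed.

Lemma is_series_Rscal (c : R) (a : nat -> R) (l : R) :
  is_series a l -> is_series (fun n => c * a n) (c * l).
Proof. exact (is_series_scal c a l). Qed.

Lemma is_series_nonneg (a : nat -> R) (l : R) :
  is_series a l -> (forall n, 0 <= a n) -> 0 <= l.
Proof.
  intros Ha H.
  assert (H0 : 0 * l <= l); [|lra].
  refine (is_series_mono _ _ _ _ _ (is_series_Rscal 0 a l Ha) Ha).
  intros n; specialize (H n); lra.
Qed.

Lemma is_series_eq (a b : nat -> R) (la lb : R) :
  (forall n, a n = b n) -> la = lb -> is_series a la -> is_series b lb.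
Proof. intros H -> Ha; exact (is_series_ext a b lb H Ha). Qed.

Lemma is_series_telescope (u : nat -> R) (l : R) :
  is_lim_seq u l -> is_series (fun n => u (S n) - u n) (l - u 0%nat).
Proof.
  intros Hu.
  assert (E : forall N, u (S N) - u 0%nat = sum_n (fun n => u (S n) - u n) N).
  { induction N as [|N IH]; [now rewrite sum_O|].
    rewrite sum_Sn_R, <- IH; ring. }
  change (is_lim_seq (sum_n (fun n => u (S n) - u n)) (Finite (l - u 0%nat))).
  apply (is_lim_seq_ext _ _ _ E).
  apply is_lim_seq_minus'; [now apply is_lim_seq_incr_1 in Hu|apply is_lim_seq_const].
Qed.

Lemma is_lim_seq_0_le (u v : nat -> R) :
  (forall n, 0 <= u n <= v n) -> is_lim_seq v 0 -> is_lim_seq u 0.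
Proof.
  intros H Hv; apply (is_lim_seq_le_le (fun _ => 0) u v); auto.
  apply is_lim_seq_const.
Qed.

Lemma is_lim_seq_opp_0 (u : nat -> R) :
  is_lim_seq u 0 -> is_lim_seq (fun n => - u n) 0.
Proof.
  intros Hu; replace (Finite 0) with (Rbar_opp 0) by (simpl; f_equal; ring).
  now apply is_lim_seq_opp in Hu.
Qed.

Lemma is_lim_seq_inv_S_plus (x : R) : 0 <= x ->
  is_lim_seq (fun n => / (INR (S n) + x)) 0.
Proof.
  intros Hx.
  apply (is_lim_seq_inv _ p_infty); [|discriminate].
  apply (is_lim_seq_le_p_loc INR); [|apply is_lim_seq_INR].
  exists 0%nat; intros n _; rewrite S_INR; lra.
Qed.

Lemma pow_ge_id (x : R) (m : nat) : 1 <= x -> (1 <= m)%nat -> x <= x ^ m.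
Proof.
  intros Hx Hm; destruct m as [|m]; [lia|]; simpl.
  assert (H := pow_R1_Rle x m Hx); nra.
Qed.

Lemma is_lim_seq_inv_pow (x : R) (m : nat) : 0 <= x -> (1 <= m)%nat ->
  is_lim_seq (fun n => / (INR (S n) + x) ^ m) 0.
Proof.
  intros Hx Hm.
  apply (is_lim_seq_0_le _ (fun n => / (INR (S n) + x))); [|now apply is_lim_seq_inv_S_plus].
  intros n; assert (H := pos_INR n); rewrite S_INR.
  assert (H1 : INR n + 1 + x <= (INR n + 1 + x) ^ m) by (apply pow_ge_id; [lra|lia]).
  split; [left; apply Rinv_0_lt_compat; lra|apply Rinv_le_contravar; lra].
Qed.

(** The terms are differences of -1/(n+x). This series serves as the comparison series for 1/n^2,
    for the decay of [hz], and for the tails in the summation by parts. *)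
Lemma is_series_inv_consecutive (x : R) : 0 < x ->
  is_series (fun n => / ((INR n + x) * (INR (S n) + x))) (/ x).
Proof.
  intros Hx.
  apply (is_series_eq (fun n => - / (INR (S n) + x) - - / (INR n + x)) _
           (0 - - / (INR 0 + x))).
  - intros n; assert (H := pos_INR n); rewrite S_INR; field; lra.
  - simpl; field; lra.
  - apply (is_series_telescope (fun n => - / (INR n + x))).
    apply is_lim_seq_opp_0.
    apply is_lim_seq_incr_1, is_lim_seq_inv_S_plus; lra.
Qed.

Lemma inv_pow_le (x : R) (m : nat) : 1 <= x -> (2 <= m)%nat -> / x ^ m <= / (x * x).
Proof.
  intros Hx Hm; destruct m as [|m]; [lia|]; simpl.
  assert (H := pow_ge_id x m Hx ltac:(lia)).
  apply Rinv_le_contravar; nra.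
Qed.

Lemma ex_series_inv_sqr : ex_series (fun n => / (INR (S n) * INR (S n))).
Proof.
  apply (ex_series_nonneg_le _ (fun n => 2 * / ((INR n + 1) * (INR (S n) + 1)))).
  - intros n; assert (H := pos_INR n); rewrite S_INR; split.
    + left; apply Rinv_0_lt_compat; nra.
    + replace (2 * / ((INR n + 1) * (INR n + 1 + 1)))
        with (/ ((INR n + 1) * (INR n + 1 + 1) / 2)) by (field; lra).
      apply Rinv_le_contravar; nra.
  - exists (2 * / 1); apply is_series_Rscal, is_series_inv_consecutive; lra.
Qed.

(** * Zeta values and shifted harmonic numbers as convergent series *)

(** The value picked by [epsilon] is meaningful only once some limit is known to exist, so
    convergence has to be proved first. *)
Lemma is_series_epsilon (a : nat -> R) : ex_series a ->
  is_series a (epsilon (inhabits 0) (fun l => infinite_sum a l)).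
Proof.
  intros [l Hl]; apply is_series_Reals.
  apply epsilon_spec; exists l; now apply is_series_Reals.
Qed.

Lemma zeta_series (s : nat) : (2 <= s)%nat ->
  is_series (fun j => / INR (S j) ^ s) (zeta s).
Proof.
  intros Hs; apply is_series_epsilon.
  apply (ex_series_nonneg_le _ (fun n => / (INR (S n) * INR (S n)))), ex_series_inv_sqr.
  intros n; assert (H := pos_INR n); rewrite S_INR; split.
  - left; apply Rinv_0_lt_compat, pow_lt; lra.
  - apply inv_pow_le; [lra|lia].
Qed.

Lemma Hm_term_nonneg (m j : nat) (x : R) : 0 <= x ->
  0 <= / INR (S j) ^ m - / (INR (S j) + x) ^ m.
Proof.
  intros Hx; assert (H := INR_S_pos j).
  apply Rge_le, Rge_minus, Rle_ge, Rinv_le_contravar; [now apply pow_lt|].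
  apply pow_incr; lra.
Qed.

Lemma Hm_series (m : nat) (x : R) : (1 <= m)%nat -> 0 <= x ->
  is_series (fun j => / INR (S j) ^ m - / (INR (S j) + x) ^ m) (Hm m x).
Proof.
  intros Hm Hx; apply is_series_epsilon.
  (* The factor 1 + x covers both cases: with p = j + 1 the term is x/(p(p+x)) <= x/p^2 for m = 1,
     and at most 1/p^2 for m >= 2. *)
  apply (ex_series_nonneg_le _ (fun n => (1 + x) * / (INR (S n) * INR (S n)))).
  2: { apply (ex_series_scal (1 + x) (fun n => / (INR (S n) * INR (S n)))), ex_series_inv_sqr. }
  intros j; split; [now apply Hm_term_nonneg|].
  assert (H := pos_INR j); rewrite S_INR; set (p := INR j + 1).
  assert (Hp : 1 <= p) by (unfold p; lra).
  assert (H2 : 0 < / (p * p)) by (apply Rinv_0_lt_compat; nra).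
  destruct (Nat.eq_dec m 1) as [->|Hm1].
  - rewrite !pow_1.
    replace (/ p - / (p + x)) with (x * / (p * (p + x))) by (field; lra).
    assert (H3 : / (p * (p + x)) <= / (p * p)) by (apply Rinv_le_contravar; nra).
    nra.
  - assert (H3 : / p ^ m <= / (p * p)) by (apply inv_pow_le; [lra|lia]).
    assert (H4 : 0 < / (p + x) ^ m) by (apply Rinv_0_lt_compat, pow_lt; lra).
    nra.
Qed.

(** For m >= 2 and x >= 0 this is the Hurwitz zeta value zeta(m, x+1). Unlike H^(m) it vanishes at
    infinity, as the uniqueness argument for difference equations requires. *)
Definition hz (m : nat) (x : R) : R := zeta m - Hm m x.

Lemma hz_series (m : nat) (x : R) : (2 <= m)%nat -> 0 <= x ->
  is_series (fun j => / (INR (S j) + x) ^ m) (hz m x).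
Proof.
  intros Hm Hx.
  refine (is_series_eq _ _ _ _ _ eq_refl
            (is_series_Rminus _ _ _ _ (zeta_series m Hm) (Hm_series m x _ Hx))); [|lia].
  intros n; simpl; ring.
Qed.

(** Subtracting the two defining series termwise leaves 1/(n+x)^m - 1/(n+1+x)^m, which
    telescopes. *)
Lemma Hm_succ (m : nat) (x : R) : (1 <= m)%nat -> 0 <= x ->
  Hm m (x + 1) = Hm m x + / (x + 1) ^ m.
Proof.
  intros Hm Hx.
  assert (H1 := is_series_Rminus _ _ _ _ (Hm_series m (x + 1) Hm ltac:(lra)) (Hm_series m x Hm Hx)).
  assert (H2 := is_series_telescope _ _ (is_lim_seq_opp_0 _ (is_lim_seq_inv_pow x m Hx Hm))).
  apply is_series_unique in H1; apply is_series_unique in H2.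
  rewrite (Series_ext _ (fun n => - / (INR (S (S n)) + x) ^ m - - / (INR (S n) + x) ^ m)) in H1.
  - rewrite H1 in H2; simpl INR in H2; rewrite (Rplus_comm x 1); rewrite (Rplus_comm x 1) in H2; lra.
  - intros n; rewrite (S_INR (S n)).
    replace (INR (S n) + (x + 1)) with (INR (S n) + 1 + x) by ring; ring.
Qed.

Lemma Hm_0 (m : nat) : (1 <= m)%nat -> Hm m 0 = 0.
Proof.
  intros Hm.
  assert (H := is_series_unique _ _ (Hm_series m 0 Hm (Rle_refl 0))).
  rewrite (Series_ext _ (fun n => 0 * 0)) in H.
  - rewrite Series_scal_l in H; lra.
  - intros n; rewrite Rplus_0_r; ring.
Qed.

(** * Nonnegative nondecreasing functions and bounds for [hz] *)

Definition nonneg_incr (F : R -> R) : Prop :=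
  (forall x, 0 <= x -> 0 <= F x) /\ (forall x y, 0 <= x <= y -> F x <= F y).

Lemma nonneg_incr_plus (F G : R -> R) :
  nonneg_incr F -> nonneg_incr G -> nonneg_incr (fun x => F x + G x).
Proof.
  intros [F0 F1] [G0 G1]; split.
  - intros x Hx; specialize (F0 x Hx); specialize (G0 x Hx); lra.
  - intros x y Hx; specialize (F1 x y Hx); specialize (G1 x y Hx); lra.
Qed.

Lemma nonneg_incr_mult (F G : R -> R) :
  nonneg_incr F -> nonneg_incr G -> nonneg_incr (fun x => F x * G x).
Proof.
  intros [F0 F1] [G0 G1]; split.
  - intros x Hx; apply Rmult_le_pos; auto.
  - intros x y Hx; apply Rmult_le_compat; auto; [apply F0|apply G0]; lra.
Qed.

Lemma nonneg_incr_const (c : R) : 0 <= c -> nonneg_incr (fun _ => c).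
Proof. intros H; split; intros; lra. Qed.

Lemma nonneg_incr_pow (F : R -> R) (n : nat) :
  nonneg_incr F -> nonneg_incr (fun x => F x ^ n).
Proof.
  intros HF; induction n as [|n IH]; simpl.
  - apply nonneg_incr_const; lra.
  - now apply nonneg_incr_mult.
Qed.

Lemma nonneg_incr_Hm (m : nat) : (1 <= m)%nat -> nonneg_incr (Hm m).
Proof.
  intros hm.
  assert (H : forall x y, 0 <= x <= y -> Hm m x <= Hm m y).
  { intros x y Hxy.
    refine (is_series_mono _ _ _ _ _ (Hm_series m x hm _) (Hm_series m y hm _)); try lra.
    intros n; assert (Hn := INR_S_pos n).
    apply Rplus_le_compat_l, Ropp_le_contravar, Rinv_le_contravar.
    - apply pow_lt; lra.
    - apply pow_incr; lra. }
  split; [|exact H].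
  intros x Hx; rewrite <- (Hm_0 m hm); apply H; lra.
Qed.

Lemma hz_nonneg (m : nat) (x : R) : (2 <= m)%nat -> 0 <= x -> 0 <= hz m x.
Proof.
  intros Hm Hx.
  apply (is_series_nonneg _ _ (hz_series m x Hm Hx)).
  intros n; assert (H := INR_S_pos n).
  left; apply Rinv_0_lt_compat, pow_lt; lra.
Qed.

(** Each term is at most 1/(n+x)^2 <= 1/((n-1+x)(n+x)) for n >= 1, and these bounds telescope to
    1/x. *)
Lemma hz_le_inv (m : nat) (x : R) : (2 <= m)%nat -> 0 < x -> hz m x <= / x.
Proof.
  intros Hm Hx.
  refine (is_series_mono _ _ _ _ _ (hz_series m x Hm ltac:(lra)) (is_series_inv_consecutive x ltac:(lra))).
  intros n; assert (H := pos_INR n); rewrite S_INR.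
  eapply Rle_trans; [apply inv_pow_le; [lra|exact Hm]|].
  apply Rinv_le_contravar; nra.
Qed.

(** * Summation by parts *)

(** This is the assertion T_F(b) = l, with the summation index shifted to start at 0. *)
Definition diff_series (F : R -> R) (b l : R) : Prop :=
  is_series (fun n => (F (INR (S n) + b) - F (INR n + b)) / INR (S n)) l.

Lemma diff_series_plus (F G : R -> R) (b l l' : R) :
  diff_series F b l -> diff_series G b l' -> diff_series (fun x => F x + G x) b (l + l').
Proof.
  intros HF HG.
  refine (is_series_eq _ _ _ _ _ eq_refl (is_series_Rplus _ _ _ _ HF HG)).
  intros n; assert (H := INR_S_pos n); cbv beta; field; lra.
Qed.

Lemma diff_series_scal (c : R) (F : R -> R) (b l : R) :
  diff_series F b l -> diff_series (fun x => c * F x) b (c * l).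
Proof.
  intros HF.
  refine (is_series_eq _ _ _ _ _ eq_refl (is_series_Rscal c _ _ HF)).
  intros n; assert (H := INR_S_pos n); cbv beta; field; lra.
Qed.

Lemma diff_series_eq (F G : R -> R) (b l l' : R) : 0 <= b ->
  (forall x, 0 <= x -> F x = G x) -> l = l' -> diff_series F b l -> diff_series G b l'.
Proof.
  intros Hb HFG -> HF.
  refine (is_series_eq _ _ _ _ _ eq_refl HF).
  intros n; assert (H := pos_INR n); assert (H' := pos_INR (S n)).
  rewrite !HFG by lra; reflexivity.
Qed.

(** Summation by parts with 1/(n(n+1)) = 1/n - 1/(n+1). *)
Lemma abel_partial_sum (F : R -> R) (b : R) (N : nat) :
  @eq R (sum_n (fun n => F (INR (S n) + b) / (INR (S n) * INR (S (S n)))) N)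
  (F b + sum_n (fun n => (F (INR (S n) + b) - F (INR n + b)) / INR (S n)) N
  - F (INR (S N) + b) / INR (S (S N))).
Proof.
  induction N as [|N IH].
  - rewrite !sum_O; simpl; rewrite Rplus_0_l; field.
  - rewrite !sum_Sn_R, IH.
    assert (H1 := INR_S_pos N); assert (H2 := INR_S_pos (S N)); assert (H3 := INR_S_pos (S (S N))).
    set (t := sum_n _ N); rewrite (S_INR (S (S N))) in *; rewrite (S_INR (S N)) in *.
    field; lra.
Qed.

Section Abel.
Variables (F : R -> R) (b : R).
Hypotheses (HF : nonneg_incr F) (Hb : 0 <= b).
Let w n := F (INR (S n) + b) / (INR (S n) * INR (S (S n))).

(** In [abel_partial_sum] the boundary term enters with a minus sign and is nonnegative, and the
    partial sums of T_F stay below l because F is nondecreasing. Hence F b + l bounds the partial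
    sums. *)
Lemma abel_ex_series (l : R) : diff_series F b l -> ex_series w.
Proof.
  intros Hl; destruct HF as [F0 F1].
  apply (ex_series_nonneg_bounded _ (F b + l)).
  - intros n; assert (H := INR_S_pos n); assert (H' := INR_S_pos (S n)).
    apply Rmult_le_pos; [apply F0; lra|left; apply Rinv_0_lt_compat; nra].
  - intros N; unfold w; rewrite abel_partial_sum.
    assert (H := INR_S_pos (S N)); assert (H' := INR_S_pos N).
    assert (0 <= F (INR (S N) + b) / INR (S (S N))).
    { apply Rmult_le_pos; [apply F0; lra|left; apply Rinv_0_lt_compat; lra]. }
    assert (sum_n (fun n => (F (INR (S n) + b) - F (INR n + b)) / INR (S n)) N <= l); [|lra].
    apply (is_lim_seq_incr_compare (sum_n (fun n => (F (INR (S n) + b) - F (INR n + b)) / INR (S n))) l Hl).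
    intros n; rewrite (sum_Sn_R _ n); cbv beta.
    assert (Hn := INR_S_pos (S n)); assert (Hn' := pos_INR (S n)).
    assert (F (INR (S n) + b) <= F (INR (S (S n)) + b)).
    { apply F1; rewrite (S_INR (S n)); lra. }
    assert (0 <= (F (INR (S (S n)) + b) - F (INR (S n) + b)) / INR (S (S n))); [|lra].
    apply Rmult_le_pos; [lra|left; apply Rinv_0_lt_compat; lra].
Qed.

(* For nondecreasing F, the tail of [sum F(n+b)/(n(n+1))] from N dominates F(N+b)/N. *)
Lemma abel_lim_0 : ex_series w ->
  is_lim_seq (fun n => F (INR (S n) + b) / INR (S n)) 0.
Proof.
  intros Hex; assert (exists W : R, is_series w W) as [W HW] by exact Hex.
  destruct HF as [F0 F1].
  apply is_lim_seq_incr_1.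
  apply (is_lim_seq_0_le _ (fun N => W - sum_n w N)).
  2: { replace (Finite 0) with (Finite (W - W)) by (f_equal; ring).
       apply is_lim_seq_minus'; [apply is_lim_seq_const|exact HW]. }
  intros N; assert (HN := INR_S_pos N); assert (HN' := INR_S_pos (S N)); split.
  { apply Rmult_le_pos; [apply F0; lra|left; apply Rinv_0_lt_compat; lra]. }
  assert (H1 : is_series (fun k => w (S N + k)%nat) (W - sum_n w N)).
  { apply is_series_incr_n; [lia|].
    apply (is_series_eq w w W); [reflexivity| |exact HW].
    change (@eq R W (W - sum_n w N + sum_n w N)); ring. }
  assert (H2 := is_series_Rscal (F (INR (S (S N)) + b)) _ _
                 (is_series_inv_consecutive (INR (S (S N))) HN')).
  refine (is_series_mono _ _ _ _ _ H2 H1).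
  intros n; unfold w.
  replace (INR (S (S N + n))) with (INR n + INR (S (S N))) by (rewrite <- plus_INR; f_equal; lia).
  replace (INR (S (S (S N + n)))) with (INR (S n) + INR (S (S N))) by (rewrite <- plus_INR; f_equal; lia).
  assert (Hn := pos_INR n); assert (Hn' := pos_INR (S n)).
  apply Rmult_le_compat_r; [left; apply Rinv_0_lt_compat; nra|].
  apply F1; lra.
Qed.

(** Convergence, already obtained from boundedness, forces the boundary term to 0; then the
    summation by parts passes to the limit. *)
Lemma abel_series (l : R) : diff_series F b l -> is_series w (F b + l).
Proof.
  intros Hl; assert (Hw := abel_ex_series l Hl); assert (H0 := abel_lim_0 Hw).
  change (is_lim_seq (sum_n w) (Finite (F b + l))).
  apply (is_lim_seq_ext _ _ _ (fun N => eq_sym (abel_partial_sum F b N))).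
  replace (Finite (F b + l)) with (Finite (F b + l - 0)) by (f_equal; ring).
  apply is_lim_seq_minus'; [apply is_lim_seq_plus'; [apply is_lim_seq_const|exact Hl]|].
  refine (is_lim_seq_0_le _ _ _ H0).
  intros n; assert (Hn := INR_S_pos n); assert (0 <= F (INR (S n) + b)) by (apply HF; lra).
  rewrite (S_INR (S n)); split.
  - apply Rmult_le_pos; [lra|left; apply Rinv_0_lt_compat; lra].
  - apply Rmult_le_compat_l; [lra|apply Rinv_le_contravar; lra].
Qed.
End Abel.

(** The difference f - g is constant along b, b+1, b+2, ..., and it tends to 0 there. *)
Lemma eq_of_diff_eq_of_lim_0 (f g : R -> R) (b : R) : 0 < b ->
  (forall x, 0 < x -> f (x + 1) - f x = g (x + 1) - g x) ->
  is_lim_seq (fun n => f (INR (S n) + b)) 0 ->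
  is_lim_seq (fun n => g (INR (S n) + b)) 0 -> f b = g b.
Proof.
  intros Hb Hd Hf Hg.
  assert (E : forall n, f (INR n + b) - g (INR n + b) = f b - g b).
  { induction n as [|n IH]; [simpl; now rewrite Rplus_0_l|].
    rewrite S_INR; replace (INR n + 1 + b) with (INR n + b + 1) by ring.
    assert (H := pos_INR n); specialize (Hd (INR n + b) ltac:(lra)); lra. }
  assert (H := is_lim_seq_minus' _ _ _ _ Hf Hg).
  apply (is_lim_seq_ext _ (fun _ => f b - g b)) in H; [|intros n; apply E].
  apply is_lim_seq_unique in H; rewrite Lim_seq_const in H.
  injection H; lra.
Qed.

(** * The recursion from P = P_{m-1} to Pn = P_m, with c = m - 1 *)

Section BellStep.
Variables (c : R) (P Pn : R -> R).
Hypotheses (Hc : 0 <= c) (HP : nonneg_incr P) (HPn : nonneg_incr Pn) (HPn0 : Pn 0 = 0)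
  (HT : forall b, 0 < b -> diff_series P b (c * P b / b))
  (Hstep : forall x, 0 <= x -> Pn (x + 1) = Pn x + (c + 1) * P (x + 1) / (x + 1)).

(** Since b/(n(n+b)) = 1/n - 1/(n+b), this is the series of H_b weighted by P(n+b). Its sum turns
    out to be [Pn b]. *)
Let s b n := b * (P (INR (S n) + b) / (INR (S n) * (INR (S n) + b))).

Lemma bell_ex_series (b : R) : 0 <= b ->
  ex_series (fun n => P (INR (S n) + b) / (INR (S n) * (INR (S n) + b))).
Proof.
  intros Hb.
  (* Moving to b + 1 makes [HT] applicable also for b = 0. The factor 2 comes from n + 1 <= 2(n + b)
     for n >= 1. *)
  apply (ex_series_nonneg_le _
    (fun n => 2 * (P (INR (S n) + (b + 1)) / (INR (S n) * INR (S (S n)))))).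
  - intros n; assert (Hn := pos_INR n); rewrite (S_INR (S n)), !(S_INR n).
    destruct HP as [P0 P1].
    assert (H0 : 0 <= P (INR n + 1 + b)) by (apply P0; lra).
    assert (H1 : P (INR n + 1 + b) <= P (INR n + 1 + (b + 1))) by (apply P1; lra).
    split; [apply Rmult_le_pos; [lra|left; apply Rinv_0_lt_compat; nra]|].
    replace (2 * (P (INR n + 1 + (b + 1)) / ((INR n + 1) * (INR n + 1 + 1))))
      with (P (INR n + 1 + (b + 1)) * / ((INR n + 1) * (INR n + 1 + 1) / 2)) by (field; lra).
    apply Rmult_le_compat; [lra|left; apply Rinv_0_lt_compat; nra|lra|].
    apply Rinv_le_contravar; nra.
  - refine (ex_series_scal 2 (fun n => P (INR (S n) + (b + 1)) / (INR (S n) * INR (S (S n)))) _).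
    apply (abel_ex_series P (b + 1) HP ltac:(lra) _ (HT (b + 1) ltac:(lra))).
Qed.

Let Sum b := Series (s b).

Lemma bell_is_series (b : R) : 0 <= b -> is_series (s b) (Sum b).
Proof.
  intros Hb; apply Series_correct.
  refine (ex_series_scal b (fun n => P (INR (S n) + b) / (INR (S n) * (INR (S n) + b))) _).
  now apply bell_ex_series.
Qed.

Lemma bell_lim (b : R) : 0 <= b -> is_lim_seq (fun n => P (INR (S n) + b) / (INR (S n) + b)) 0.
Proof.
  intros Hb.
  assert (H := abel_lim_0 P (b + 1) HP ltac:(lra)
                 (abel_ex_series P (b + 1) HP ltac:(lra) _ (HT (b + 1) ltac:(lra)))).
  refine (is_lim_seq_0_le _ _ _ H).
  intros n; assert (Hn := INR_S_pos n); destruct HP as [P0 P1].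
  assert (H0 : 0 <= P (INR (S n) + b)) by (apply P0; lra).
  assert (H1 : P (INR (S n) + b) <= P (INR (S n) + (b + 1))) by (apply P1; lra).
  split; [apply Rmult_le_pos; [lra|left; apply Rinv_0_lt_compat; lra]|].
  apply Rmult_le_compat; [lra|left; apply Rinv_0_lt_compat; lra|lra|].
  apply Rinv_le_contravar; lra.
Qed.

(** With b/(n(n+b)) = 1/n - 1/(n+b), the two series differ by T_P(b+1) minus a telescoping series in
    P(x)/x. These contribute c and 1 times P(b+1)/(b+1). *)
Lemma bell_sum_succ (b : R) : 0 <= b -> Sum (b + 1) = Sum b + (c + 1) * P (b + 1) / (b + 1).
Proof.
  intros Hb.
  assert (H1 := bell_is_series b Hb).
  assert (H2 := HT (b + 1) ltac:(lra)).
  assert (H3 := is_series_telescope _ _ (bell_lim b Hb)).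
  assert (H4 := is_series_Rminus _ _ _ _ (is_series_Rplus _ _ _ _ H1 H2) H3).
  apply is_series_unique; refine (is_series_eq _ _ _ _ _ _ H4).
  - intros n; unfold s; assert (Hn := pos_INR n).
    replace (INR n + (b + 1)) with (INR (S n) + b) by (rewrite S_INR; ring).
    replace (INR (S (S n)) + b) with (INR (S n) + (b + 1)) by (rewrite (S_INR (S n)); ring).
    rewrite !S_INR; field; lra.
  - change (INR 1) with 1; rewrite (Rplus_comm 1 b); field; lra.
Qed.

(** Both factors of a term, P(n+b) and 1/n - 1/(n+b), are nonnegative and nondecreasing in b. *)
Lemma bell_sum_mono (x y : R) : 0 <= x <= y -> Sum x <= Sum y.
Proof.
  intros Hxy.
  refine (is_series_mono _ _ _ _ _ (bell_is_series x _) (bell_is_series y _)); try lra.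
  intros n; unfold s; assert (Hn := INR_S_pos n); set (p := INR (S n)) in *.
  destruct HP as [P0 P1].
  assert (H0 : 0 <= P (p + x)) by (apply P0; lra).
  assert (H1 : P (p + x) <= P (p + y)) by (apply P1; lra).
  replace (x * (P (p + x) / (p * (p + x)))) with (P (p + x) * (/ p - / (p + x))) by (field; lra).
  replace (y * (P (p + y) / (p * (p + y)))) with (P (p + y) * (/ p - / (p + y))) by (field; lra).
  assert (/ (p + x) <= / p) by (apply Rinv_le_contravar; lra).
  assert (/ (p + y) <= / (p + x)) by (apply Rinv_le_contravar; lra).
  apply Rmult_le_compat; lra.
Qed.

Lemma bell_sum_diff (n : nat) (b : R) : 0 <= b -> Sum (INR n + b) - Pn (INR n + b) = Sum b - Pn b.
Proof.
  intros Hb; induction n as [|n IH]; [simpl; now rewrite Rplus_0_l|].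
  rewrite S_INR; replace (INR n + 1 + b) with (INR n + b + 1) by ring.
  assert (H := pos_INR n); rewrite bell_sum_succ, Hstep by lra; lra.
Qed.

(** Each unit step adds (c+1) P(x)/x, which tends to 0. Integer increments suffice, because any b
    lies below some integer K. *)
Lemma bell_increment_lim (K : nat) :
  is_lim_seq (fun n => Pn (INR (S n) + INR K) - Pn (INR (S n))) 0.
Proof.
  induction K as [|K IH].
  - apply (is_lim_seq_ext (fun _ => 0)); [|apply is_lim_seq_const].
    intros n; simpl (INR 0); rewrite Rplus_0_r; ring.
  - assert (H := is_lim_seq_scal_l _ (c + 1) _ (bell_lim (INR (S K)) (pos_INR _))).
    assert (H' := is_lim_seq_plus' _ _ _ _ IH H).
    replace (0 + (c + 1) * 0) with 0 in H' by ring.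
    refine (is_lim_seq_ext _ _ _ _ H').
    intros n; assert (Hn := INR_S_pos n); assert (HK := pos_INR K).
    rewrite (S_INR K); replace (INR (S n) + (INR K + 1)) with (INR (S n) + INR K + 1) by ring.
    rewrite Hstep by lra; field; lra.
Qed.

(* [Sum] and [Pn] satisfy the same difference equation and agree at 0, hence at the
   integers; being monotone with increments tending to 0, they agree everywhere. *)
Lemma bell_sum_eq (b : R) : 0 <= b -> Sum b = Pn b.
Proof.
  intros Hb.
  assert (H0 : forall n, Sum (INR n) = Pn (INR n)).
  { intros n; assert (H := bell_sum_diff n 0 (Rle_refl 0)); rewrite Rplus_0_r in H.
    assert (E : Sum 0 = 0); [|lra].
    unfold Sum; rewrite (Series_ext _ (fun n => 0 * 0)).
    - rewrite Series_scal_l; ring.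
    - intros k; unfold s; ring. }
  destruct (INR_unbounded b) as [K HK].
  (* With N = n + 1, both [Sum] and [Pn] at N + b lie between Pn(N) and Pn(N+K). *)
  assert (Habs : forall n, Rabs (Sum b - Pn b) <= Pn (INR (S n) + INR K) - Pn (INR (S n))).
  { intros n; assert (Hn := INR_S_pos n).
    rewrite <- (bell_sum_diff (S n) b Hb).
    assert (S1 : Sum (INR (S n)) <= Sum (INR (S n) + b)) by (apply bell_sum_mono; lra).
    assert (S2 : Sum (INR (S n) + b) <= Sum (INR (S n) + INR K)) by (apply bell_sum_mono; lra).
    assert (Q1 : Pn (INR (S n)) <= Pn (INR (S n) + b)) by (apply HPn; lra).
    assert (Q2 : Pn (INR (S n) + b) <= Pn (INR (S n) + INR K)) by (apply HPn; lra).
    rewrite H0 in S1; rewrite <- plus_INR, H0, plus_INR in S2.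
    apply Rabs_le; lra. }
  assert (H := is_lim_seq_le _ _ _ _ Habs (is_lim_seq_const _) (bell_increment_lim K)).
  simpl in H; assert (H' := Rabs_pos (Sum b - Pn b)).
  assert (E : Rabs (Sum b - Pn b) = 0) by lra.
  destruct (Req_dec (Sum b - Pn b) 0) as [|N]; [lra|].
  apply Rabs_no_R0 in N; contradiction.
Qed.

Lemma bell_series (b : R) : 0 < b ->
  is_series (fun n => P (INR (S n) + b) / (INR (S n) * (INR (S n) + b))) (Pn b / b).
Proof.
  intros Hb; assert (H := bell_is_series b ltac:(lra)); rewrite bell_sum_eq in H by lra.
  refine (is_series_eq _ _ _ _ _ _ (is_series_Rscal (/ b) _ _ H)).
  - intros n; unfold s; assert (Hn := INR_S_pos n); field; lra.
  - field; lra.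
Qed.

(** By [Hstep] the increment of [Pn] ending at n + b is (c+1) P(n+b)/(n+b), so T_Pn is c + 1 times
    the series of [bell_series]. The result has the shape of [HT], so the recursion can continue. *)
Lemma bell_diff_series (b : R) : 0 < b -> diff_series Pn b ((c + 1) * Pn b / b).
Proof.
  intros Hb.
  refine (is_series_eq _ _ _ _ _ _ (is_series_Rscal (c + 1) _ _ (bell_series b Hb))).
  - intros n; assert (Hn := pos_INR n).
    replace (INR (S n) + b) with (INR n + b + 1) by (rewrite S_INR; ring).
    rewrite Hstep by lra; rewrite S_INR; field; lra.
  - field; lra.
Qed.
End BellStep.

(** * T for H^(m) by partial fractions *)

Lemma hz_succ (m : nat) (x : R) : (1 <= m)%nat -> 0 <= x ->
  hz m (x + 1) = hz m x - / (x + 1) ^ m.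
Proof. intros Hm Hx; unfold hz; rewrite Hm_succ by assumption; ring. Qed.

Lemma Hm_pred (m n : nat) (b : R) : (1 <= m)%nat -> 0 <= b ->
  Hm m (INR n + b) = Hm m (INR (S n) + b) - / (INR (S n) + b) ^ m.
Proof.
  intros Hm Hb; assert (H := pos_INR n).
  replace (INR (S n) + b) with (INR n + b + 1) by (rewrite S_INR; ring).
  rewrite Hm_succ by lra || assumption; ring.
Qed.

Lemma hz_pred (m n : nat) (b : R) : (1 <= m)%nat -> 0 <= b ->
  hz m (INR n + b) = hz m (INR (S n) + b) + / (INR (S n) + b) ^ m.
Proof. intros Hm Hb; unfold hz; rewrite Hm_pred by assumption; ring. Qed.

(* [TH m b] is the sum of 1/(n (n+b)^(m+1)), by the partial fraction
   1/(n x) = (1/n - 1/x)/b with x = n + b. *)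
Fixpoint TH (m : nat) (b : R) : R :=
  match m with
  | O => Hm 1 b / b
  | S m' => (TH m' b - hz (S m) b) / b
  end.

Lemma TH_series (m : nat) (b : R) : 0 < b ->
  is_series (fun n => / (INR (S n) * (INR (S n) + b) ^ S m)) (TH m b).
Proof.
  intros Hb; induction m as [|m IH].
  - refine (is_series_eq _ _ _ _ _ _
              (is_series_Rscal (/ b) _ _ (Hm_series 1 b (le_n 1) (Rlt_le _ _ Hb)))).
    + intros n; assert (H := INR_S_pos n); rewrite !pow_1; field; lra.
    + unfold TH; field; lra.
  - refine (is_series_eq _ _ _ _ _ _ (is_series_Rscal (/ b) _ _
              (is_series_Rminus _ _ _ _ IH (hz_series (S (S m)) b _ (Rlt_le _ _ Hb))))).
    + intros n; assert (H := INR_S_pos n).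
      assert (Hp : 0 < (INR (S n) + b) ^ m) by (apply pow_lt; lra).
      rewrite <- !tech_pow_Rmult; field; lra.
    + change (TH (S m) b) with ((TH m b - hz (S (S m)) b) / b); field; lra.
    + lia.
Qed.

Lemma diff_series_Hm (m : nat) (b : R) : 0 < b -> diff_series (Hm (S m)) b (TH m b).
Proof.
  intros Hb; refine (is_series_eq _ _ _ _ _ eq_refl (TH_series m b Hb)).
  intros n; assert (H := INR_S_pos n).
  rewrite (Hm_pred (S m) n b) by (lia || lra).
  assert (Hp : 0 < (INR (S n) + b) ^ S m) by (apply pow_lt; lra).
  field; lra.
Qed.

(** For m = 0 the constant [zeta 1] is an arbitrary real, but it cancels in the differences. *)
Lemma diff_series_hz (m : nat) (b : R) : 0 < b -> diff_series (hz (S m)) b (- TH m b).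
Proof.
  intros Hb; refine (is_series_eq _ _ _ _ _ _ (is_series_Rscal (-1) _ _ (diff_series_Hm m b Hb))).
  - intros n; assert (H := INR_S_pos n); unfold hz; field; lra.
  - ring.
Qed.

(** * The polynomials P_2 and P_3 *)

(** [P2] and [P3] are 2! and 3! times the complete homogeneous symmetric functions whose power sums
    are the H^(i). That is the source of their one-step recursion. *)
Definition P2 (x : R) : R := Hm 1 x ^ 2 + Hm 2 x.
Definition P3 (x : R) : R := Hm 1 x ^ 3 + 3 * (Hm 1 x * Hm 2 x) + 2 * Hm 3 x.

Lemma nonneg_incr_P2 : nonneg_incr P2.
Proof.
  apply (nonneg_incr_plus (fun x => Hm 1 x ^ 2) (Hm 2)).
  - apply nonneg_incr_pow, nonneg_incr_Hm; lia.
  - apply nonneg_incr_Hm; lia.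
Qed.

Lemma nonneg_incr_P3 : nonneg_incr P3.
Proof.
  assert (H : forall m, nonneg_incr (Hm (S m))) by (intros; apply nonneg_incr_Hm; lia).
  unfold P3; apply (nonneg_incr_plus (fun x => Hm 1 x ^ 3 + 3 * (Hm 1 x * Hm 2 x))
                      (fun x => 2 * Hm 3 x)).
  - apply (nonneg_incr_plus (fun x => Hm 1 x ^ 3) (fun x => 3 * (Hm 1 x * Hm 2 x))).
    + now apply nonneg_incr_pow.
    + apply (nonneg_incr_mult (fun _ => 3) (fun x => Hm 1 x * Hm 2 x)).
      * apply nonneg_incr_const; lra.
      * now apply nonneg_incr_mult.
  - apply (nonneg_incr_mult (fun _ => 2) (Hm 3)); [apply nonneg_incr_const; lra|auto].
Qed.

Lemma P2_succ (x : R) : 0 <= x -> P2 (x + 1) = P2 x + (1 + 1) * Hm 1 (x + 1) / (x + 1).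
Proof. intros Hx; unfold P2; rewrite !Hm_succ by (lia || lra); field; lra. Qed.

Lemma P3_succ (x : R) : 0 <= x -> P3 (x + 1) = P3 x + (1 + 1 + 1) * P2 (x + 1) / (x + 1).
Proof. intros Hx; unfold P2, P3; rewrite !Hm_succ by (lia || lra); field; lra. Qed.

(** Start of the recursion; the factor 1 is written out to match [HT] with c = 1. *)
Lemma diff_series_H1 (b : R) : 0 < b -> diff_series (Hm 1) b (1 * Hm 1 b / b).
Proof.
  intros Hb; assert (H := diff_series_Hm 0 b Hb); simpl TH in H.
  now rewrite Rmult_1_l.
Qed.

Lemma H1_over_series (b : R) : 0 < b ->
  is_series (fun n => Hm 1 (INR (S n) + b) / (INR (S n) * (INR (S n) + b))) (P2 b / b).
Proof.
  apply (bell_series 1 (Hm 1) P2); try exact P2_succ; try exact diff_series_H1;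
    try exact nonneg_incr_P2; try lra.
  - apply nonneg_incr_Hm; lia.
  - unfold P2; rewrite !Hm_0 by lia; ring.
Qed.

Lemma diff_series_P2 (b : R) : 0 < b -> diff_series P2 b ((1 + 1) * P2 b / b).
Proof.
  apply (bell_diff_series 1 (Hm 1) P2); try exact P2_succ; try exact diff_series_H1;
    try exact nonneg_incr_P2; try lra.
  - apply nonneg_incr_Hm; lia.
  - unfold P2; rewrite !Hm_0 by lia; ring.
Qed.

Lemma diff_series_P3 (b : R) : 0 < b -> diff_series P3 b ((1 + 1 + 1) * P3 b / b).
Proof.
  apply (bell_diff_series (1 + 1) P2 P3); try exact P3_succ; try exact diff_series_P2;
    try exact nonneg_incr_P2; try exact nonneg_incr_P3; try lra.
  unfold P3; rewrite !Hm_0 by lia; ring.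
Qed.

(** * Vanishing at infinity *)

Lemma lim_H1_over (b : R) : 0 <= b ->
  is_lim_seq (fun n => Hm 1 (INR (S n) + b) / (INR (S n) + b)) 0.
Proof.
  apply (bell_lim 1); [apply nonneg_incr_Hm; lia|exact diff_series_H1].
Qed.

Lemma lim_P2_over (b : R) : 0 <= b ->
  is_lim_seq (fun n => P2 (INR (S n) + b) / (INR (S n) + b)) 0.
Proof. apply (bell_lim (1 + 1)); [apply nonneg_incr_P2|exact diff_series_P2]. Qed.

Lemma H1_nonneg (x : R) : 0 <= x -> 0 <= Hm 1 x.
Proof. apply nonneg_incr_Hm; lia. Qed.

Lemma lim_hz (m : nat) (b : R) : (2 <= m)%nat -> 0 <= b ->
  is_lim_seq (fun n => hz m (INR (S n) + b)) 0.
Proof.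
  intros Hm Hb.
  refine (is_lim_seq_0_le _ _ _ (is_lim_seq_inv_S_plus b Hb)).
  intros n; assert (H := INR_S_pos n).
  split; [apply hz_nonneg|apply hz_le_inv]; lra || assumption.
Qed.

Lemma lim_H1_hz (m : nat) (b : R) : (2 <= m)%nat -> 0 <= b ->
  is_lim_seq (fun n => Hm 1 (INR (S n) + b) * hz m (INR (S n) + b)) 0.
Proof.
  intros Hm Hb.
  refine (is_lim_seq_0_le _ _ _ (lim_H1_over b Hb)).
  intros n; assert (H := INR_S_pos n).
  assert (H0 := H1_nonneg (INR (S n) + b) ltac:(lra)).
  split; [apply Rmult_le_pos; [lra|]|apply Rmult_le_compat_l; [lra|]].
  - apply hz_nonneg; lra || assumption.
  - apply hz_le_inv; lra || assumption.
Qed.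

(** The bounds H^2 <= P_2 and h_m <= 1/x reduce this to [lim_P2_over]; the recursion takes the place
    of a growth estimate for H. *)
Lemma lim_H1_sqr_hz (m : nat) (b : R) : (2 <= m)%nat -> 0 <= b ->
  is_lim_seq (fun n => Hm 1 (INR (S n) + b) ^ 2 * hz m (INR (S n) + b)) 0.
Proof.
  intros hm Hb.
  refine (is_lim_seq_0_le _ _ _ (lim_P2_over b Hb)).
  intros n; assert (H := INR_S_pos n); set (x := INR (S n) + b); assert (Hx : 0 < x) by (unfold x; lra).
  assert (H0 := pow2_ge_0 (Hm 1 x)).
  assert (H2 : 0 <= Hm 2 x) by (apply nonneg_incr_Hm; [lia|lra]).
  assert (Hz := hz_nonneg m x hm ltac:(lra)); assert (Hz' := hz_le_inv m x hm Hx).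
  split; [now apply Rmult_le_pos|].
  apply Rmult_le_compat; auto; unfold P2; lra.
Qed.

(* The sum and g satisfy the same difference equation and both
   vanish at infinity. *)
Lemma series_of_diff_series (F q Q g : R -> R) :
  (forall x, 0 < x -> 0 <= F x <= q x) ->
  (forall b, 0 < b -> is_series (fun n => q (INR (S n) + b) / INR (S n)) (Q b)) ->
  (forall b, 0 < b -> is_lim_seq (fun n => Q (INR (S n) + b)) 0) ->
  (forall b, 0 < b -> is_lim_seq (fun n => g (INR (S n) + b)) 0) ->
  (forall x, 0 < x -> diff_series F (x + 1) (g (x + 1) - g x)) ->
  forall b, 0 < b -> is_series (fun n => F (INR (S n) + b) / INR (S n)) (g b).
Proof.
  intros HF Hq HQ Hg Hd.
  set (f b := Series (fun n => F (INR (S n) + b) / INR (S n))).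
  assert (Hle : forall b, 0 < b -> forall n,
    0 <= F (INR (S n) + b) / INR (S n) <= q (INR (S n) + b) / INR (S n)).
  { intros b Hb n; assert (H := INR_S_pos n); destruct (HF (INR (S n) + b) ltac:(lra)).
    assert (0 < / INR (S n)) by now apply Rinv_0_lt_compat.
    split; [apply Rmult_le_pos; lra|apply Rmult_le_compat_r; lra]. }
  assert (Hf : forall b, 0 < b -> is_series (fun n => F (INR (S n) + b) / INR (S n)) (f b)).
  { intros b Hb; apply Series_correct.
    apply (ex_series_nonneg_le _ _ (Hle b Hb)); exists (Q b); auto. }
  intros b Hb; rewrite <- (eq_of_diff_eq_of_lim_0 f g b Hb); auto.
  - intros x Hx.
    assert (H1 := is_series_Rminus _ _ _ _ (Hf (x + 1) ltac:(lra)) (Hf x Hx)).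
    assert (H2 := Hd x Hx); apply is_series_unique in H1; apply is_series_unique in H2.
    rewrite <- H1, <- H2; apply Series_ext; intros n.
    assert (H := INR_S_pos n).
    replace (INR n + (x + 1)) with (INR (S n) + x) by (rewrite S_INR; ring).
    field; lra.
  (* The sum of the majorant q squeezes f between 0 and Q. *)
  - refine (is_lim_seq_0_le _ _ _ (HQ b Hb)).
    intros N; assert (HN := INR_S_pos N); assert (Hc : 0 < INR (S N) + b) by lra.
    split.
    + apply (is_series_nonneg _ _ (Hf _ Hc)); intros n; apply Hle, Hc.
    + refine (is_series_mono _ _ _ _ _ (Hf _ Hc) (Hq _ Hc)); intros n; apply Hle, Hc.
Qed.

(** * Sums involving h_2, and T for the three products *)

Definition sum_hz2 (b : R) : R := Hm 1 b * hz 2 b + hz 3 b.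

Lemma sum_hz2_series (b : R) : 0 < b ->
  is_series (fun n => hz 2 (INR (S n) + b) / INR (S n)) (sum_hz2 b).
Proof.
  (* The majorant is h_2(x) <= 1/x, and 1/(n(n+b)) sums to H_b/b, which tends to 0. *)
  revert b; apply (series_of_diff_series _ (fun x => / x) (fun b => Hm 1 b / b)).
  - intros x Hx; split; [apply hz_nonneg|apply hz_le_inv]; lia || lra.
  - intros b Hb; refine (is_series_eq _ _ _ _ _ eq_refl (TH_series 0 b Hb)).
    intros n; assert (H := INR_S_pos n); rewrite pow_1; field; lra.
  - intros b Hb; apply lim_H1_over; lra.
  - intros b Hb; replace (Finite 0) with (Finite (0 + 0)) by (f_equal; ring).
    apply is_lim_seq_plus'; [apply lim_H1_hz|apply lim_hz]; lia || lra.
  - intros x Hx; refine (is_series_eq _ _ _ _ _ _ (diff_series_hz 1 (x + 1) _)); [reflexivity| |lra].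
    unfold sum_hz2, TH; rewrite !Hm_succ, !hz_succ by (lia || lra); field; lra.
Qed.

(** With x = n + b, the increment of H h_2 ending at x is d = h_2/x - H/x^2 + 1/x^3, and d/n = (x
    d/n - d)/b. The sums of h_2/n, H/(n x) and 1/(n x^2) give the first three summands; -d
    telescopes to the last. *)
Definition TH1hz2 (b : R) : R :=
  (sum_hz2 b - P2 b / b + TH 1 b + Hm 1 b * hz 2 b) / b.

Lemma diff_series_H1_hz2 (b : R) : 0 < b ->
  diff_series (fun x => Hm 1 x * hz 2 x) b (TH1hz2 b).
Proof.
  intros Hb.
  assert (L := lim_H1_hz 2 b (le_n 2) (Rlt_le _ _ Hb)).
  (* Reindexed from n = 0, so that the telescoping starts at b itself. *)
  apply (is_lim_seq_incr_1 (fun n => Hm 1 (INR n + b) * hz 2 (INR n + b))) in L.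
  refine (is_series_eq _ _ _ _ _ _ (is_series_Rscal (/ b) _ _
    (is_series_Rminus _ _ _ _ (is_series_Rplus _ _ _ _
       (is_series_Rminus _ _ _ _ (sum_hz2_series b Hb) (H1_over_series b Hb)) (TH_series 1 b Hb))
       (is_series_telescope _ _ L)))).
  - intros n; assert (H := INR_S_pos n); cbv beta.
    rewrite (Hm_pred 1 n b), (hz_pred 2 n b) by (lia || lra); field; lra.
  - change (INR 0) with 0; rewrite Rplus_0_l; unfold TH1hz2; field; lra.
Qed.

(** The increment from b - 1 to b has to be [TH1hz2 b]. The increment of H^2 h_2 + H h_3 misses it
    by h_2/b^2 - zeta(2)/b^2: the term zeta(2) h_2 supplies the second part, and (h_4 - h_2^2)/2 the
    first. *)
Definition sum_H1_hz2 (b : R) : R :=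
  Hm 1 b ^ 2 * hz 2 b + Hm 1 b * hz 3 b + zeta 2 * hz 2 b
  + - / 2 * (hz 2 b * hz 2 b) + / 2 * hz 4 b.

Lemma sum_H1_hz2_series (b : R) : 0 < b ->
  is_series (fun n => Hm 1 (INR (S n) + b) * hz 2 (INR (S n) + b) / INR (S n)) (sum_H1_hz2 b).
Proof.
  revert b; apply (series_of_diff_series (fun x => Hm 1 x * hz 2 x)
                     (fun x => Hm 1 x * / x) (fun b => P2 b / b)).
  - intros x Hx; assert (H := H1_nonneg x ltac:(lra)).
    assert (Hz := hz_nonneg 2 x ltac:(lia) ltac:(lra)); assert (Hz' := hz_le_inv 2 x ltac:(lia) Hx).
    split; [now apply Rmult_le_pos|now apply Rmult_le_compat_l].
  - intros b Hb; refine (is_series_eq _ _ _ _ _ eq_refl (H1_over_series b Hb)).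
    intros n; assert (H := INR_S_pos n); field; lra.
  - intros b Hb; apply lim_P2_over; lra.
  - intros b Hb; unfold sum_H1_hz2.
    replace (Finite 0) with (Finite (0 + 0 + zeta 2 * 0 + - / 2 * (0 * 0) + / 2 * 0))
      by (f_equal; ring).
    assert (Hz : forall m, is_lim_seq (fun n => hz (S (S m)) (INR (S n) + b)) 0)
      by (intros m; apply lim_hz; lia || lra).
    repeat apply is_lim_seq_plus'.
    + apply lim_H1_sqr_hz; lia || lra.
    + apply lim_H1_hz; lia || lra.
    + apply (is_lim_seq_scal_l _ (zeta 2) 0), Hz.
    + apply (is_lim_seq_scal_l (fun n => hz 2 (INR (S n) + b) * hz 2 (INR (S n) + b))
               (- / 2) (Finite (0 * 0))).
      apply is_lim_seq_mult'; apply Hz.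
    + apply (is_lim_seq_scal_l _ (/ 2) 0), Hz.
  - intros x Hx; refine (is_series_eq _ _ _ _ _ _ (diff_series_H1_hz2 (x + 1) _)); [reflexivity| |lra].
    unfold sum_H1_hz2, TH1hz2, sum_hz2, P2, TH.
    (* For [field], H^(2) and h_2 must be expressed through a single unknown. *)
    assert (E : Hm 2 x = zeta 2 - hz 2 x) by (unfold hz; ring).
    rewrite !Hm_succ, !hz_succ by (lia || lra); rewrite E; field; lra.
Qed.

(** The device of [TH1hz2] again. Here x d/n is 2 H h_2/n - (H^2 + h_2)/(n x) + 2 H/(n x^2) - 1/(n
    x^3). The sum of H^2/(n x) enters through that of P_2/(n x), and the sum of H/(n x^2) through
    [TH1hz2]; [TH 0] and [TH 2] correct the remainder. *)
Definition TH1sqr_hz2 (b : R) : R :=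
  (2 * sum_H1_hz2 b - P3 b / b + zeta 2 * TH 0 b - 2 * TH1hz2 b + TH 2 b
   + Hm 1 b ^ 2 * hz 2 b) / b.

Lemma diff_series_H1_sqr_hz2 (b : R) : 0 < b ->
  diff_series (fun x => Hm 1 x ^ 2 * hz 2 x) b (TH1sqr_hz2 b).
Proof.
  intros Hb.
  assert (L := lim_H1_sqr_hz 2 b (le_n 2) (Rlt_le _ _ Hb)).
  apply (is_lim_seq_incr_1 (fun n => Hm 1 (INR n + b) ^ 2 * hz 2 (INR n + b))) in L.
  refine (is_series_eq _ _ _ _ _ _ (is_series_Rscal (/ b) _ _
    (is_series_Rminus _ _ _ _ (is_series_Rplus _ _ _ _ (is_series_Rminus _ _ _ _
      (is_series_Rplus _ _ _ _ (is_series_Rminus _ _ _ _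
       (is_series_Rscal 2 _ _ (sum_H1_hz2_series b Hb))
       (* One third of T for P_3 is the sum of P_2(x)/(n x). *)
       (is_series_Rscal (/ 3) _ _ (diff_series_P3 b Hb)))
       (is_series_Rscal (zeta 2) _ _ (diff_series_Hm 0 b Hb)))
       (is_series_Rscal 2 _ _ (diff_series_H1_hz2 b Hb)))
       (diff_series_Hm 2 b Hb))
       (is_series_telescope _ _ L)))).
  - intros n; assert (H := INR_S_pos n); cbv beta; unfold P3.
    rewrite (Hm_pred 1 n b), (Hm_pred 2 n b), (Hm_pred 3 n b), (hz_pred 2 n b) by (lia || lra).
    assert (E : Hm 2 (INR (S n) + b) = zeta 2 - hz 2 (INR (S n) + b)) by (unfold hz; ring).
    rewrite E; field; lra.
  - change (INR 0) with 0; rewrite Rplus_0_l; unfold TH1sqr_hz2; field; lra.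
Qed.

(** From H H^(2) = zeta(2) H - H h_2. *)
Definition TH1H2 (b : R) : R := zeta 2 * TH 0 b + -1 * TH1hz2 b.

Lemma diff_series_H1_H2 (b : R) : 0 < b ->
  diff_series (fun x => Hm 1 x * Hm 2 x) b (TH1H2 b).
Proof.
  intros Hb.
  refine (diff_series_eq _ _ b _ _ (Rlt_le _ _ Hb) _ eq_refl
    (diff_series_plus _ _ _ _ _ (diff_series_scal (zeta 2) _ _ _ (diff_series_Hm 0 b Hb))
       (diff_series_scal (-1) _ _ _ (diff_series_H1_hz2 b Hb)))).
  intros x Hx; unfold hz; ring.
Qed.

(** From H^3 = P_3 - 3 H H^(2) - 2 H^(3). *)
Definition TH1cube (b : R) : R :=
  (1 + 1 + 1) * P3 b / b + (-3 * TH1H2 b + -2 * TH 2 b).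

Lemma diff_series_H1_cube (b : R) : 0 < b ->
  diff_series (fun x => Hm 1 x ^ 3) b (TH1cube b).
Proof.
  intros Hb.
  refine (diff_series_eq _ _ b _ _ (Rlt_le _ _ Hb) _ eq_refl
    (diff_series_plus _ _ _ _ _ (diff_series_P3 b Hb)
       (diff_series_plus _ _ _ _ _ (diff_series_scal (-3) _ _ _ (diff_series_H1_H2 b Hb))
          (diff_series_scal (-2) _ _ _ (diff_series_Hm 2 b Hb))))).
  intros x Hx; unfold P3; ring.
Qed.

(** From H^2 H^(2) = zeta(2) (P_2 - H^(2)) - H^2 h_2. *)
Definition TH1sqrH2 (b : R) : R :=
  zeta 2 * ((1 + 1) * P2 b / b + -1 * TH 1 b) + -1 * TH1sqr_hz2 b.

Lemma diff_series_H1_sqr_H2 (b : R) : 0 < b ->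
  diff_series (fun x => Hm 1 x ^ 2 * Hm 2 x) b (TH1sqrH2 b).
Proof.
  intros Hb.
  refine (diff_series_eq _ _ b _ _ (Rlt_le _ _ Hb) _ eq_refl
    (diff_series_plus _ _ _ _ _
       (diff_series_scal (zeta 2) _ _ _ (diff_series_plus _ _ _ _ _ (diff_series_P2 b Hb)
          (diff_series_scal (-1) _ _ _ (diff_series_Hm 1 b Hb))))
       (diff_series_scal (-1) _ _ _ (diff_series_H1_sqr_hz2 b Hb)))).
  intros x Hx; unfold P2, hz; ring.
Qed.

(** * The algebra of finite sums of terms *)

Definition sumT (a : R) (ts : list term) : R := fold_right Rplus 0 (map (term_eval a) ts).

Lemma sumT_app (a : R) (ts us : list term) : sumT a (ts ++ us) = sumT a ts + sumT a us.
Proof.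
  unfold sumT; induction ts as [|t ts IH]; simpl; [ring|rewrite IH; ring].
Qed.

Fixpoint padd (p q : list Q) : list Q :=
  match p, q with
  | nil, _ => q
  | _, nil => p
  | c :: p', d :: q' => (c + d)%Q :: padd p' q'
  end.

Fixpoint pmul (p q : list Q) : list Q :=
  match p with
  | nil => nil
  | c :: p' => padd (map (Qmult c) q) (0%Q :: pmul p' q)
  end.

Lemma peval_padd (p q : list Q) (x : R) : peval (padd p q) x = peval p x + peval q x.
Proof.
  revert q; induction p as [|c p IH]; intros [|d q]; simpl; try ring.
  rewrite IH, Q2R_plus; ring.
Qed.

Lemma peval_map_Qmult (c : Q) (q : list Q) (x : R) :
  peval (map (Qmult c) q) x = Q2R c * peval q x.
Proof.
  induction q as [|d q IH]; simpl; [ring|rewrite IH, Q2R_mult; ring].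
Qed.

Lemma peval_pmul (p q : list Q) (x : R) : peval (pmul p q) x = peval p x * peval q x.
Proof.
  induction p as [|c p IH]; simpl; [ring|].
  rewrite peval_padd, peval_map_Qmult; simpl; rewrite IH, RMicromega.Q2R_0; ring.
Qed.

Lemma prodR_app (l l' : list R) : prodR (l ++ l') = prodR l * prodR l'.
Proof. unfold prodR; induction l as [|x l IH]; simpl; [ring|rewrite IH; ring]. Qed.

Definition tmul (t u : term) : term :=
  mkTerm (pmul (t_num t) (t_num u)) (pmul (t_den t) (t_den u))
    (t_zetas t ++ t_zetas u) (t_harms t ++ t_harms u).

Lemma tmul_valid (t u : term) : term_valid t -> term_valid u -> term_valid (tmul t u).
Proof. intros [H1 H2] [H3 H4]; split; apply Forall_app; auto. Qed.

Lemma tmul_ok (a : R) (t u : term) :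
  term_ok_at a t -> term_ok_at a u -> term_ok_at a (tmul t u).
Proof.
  intros [H1 H2] [H3 H4]; split; [|apply Forall_app; auto].
  simpl; rewrite peval_pmul; now apply Rmult_integral_contrapositive_currified.
Qed.

Lemma tmul_eval (a : R) (t u : term) : term_ok_at a t -> term_ok_at a u ->
  term_eval a (tmul t u) = term_eval a t * term_eval a u.
Proof.
  intros [H1 _] [H3 _]; unfold term_eval; simpl.
  rewrite !map_app, !prodR_app, !peval_pmul; field; auto.
Qed.

(** As in [representable], the list is chosen before a, so one formula serves every a > M. *)
Definition rep (M : R) (g : R -> R) : Prop :=
  exists ts : list term,
    Forall term_valid ts /\
    forall a : R, a > M -> Forall (term_ok_at a) ts /\ g a = sumT a ts.

Lemma rep_ext (M : R) (f g : R -> R) : (forall a, a > M -> f a = g a) -> rep M f -> rep M g.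
Proof.
  intros E (ts & V & H); exists ts; split; [exact V|].
  intros a Ha; destruct (H a Ha); split; [assumption|now rewrite <- E].
Qed.

Lemma rep_plus (M : R) (f g : R -> R) : rep M f -> rep M g -> rep M (fun a => f a + g a).
Proof.
  intros (ts & V & H) (us & V' & H'); exists (ts ++ us); split; [now apply Forall_app|].
  intros a Ha; destruct (H a Ha) as [O E]; destruct (H' a Ha) as [O' E'].
  split; [now apply Forall_app|now rewrite sumT_app, E, E'].
Qed.

Lemma rep_mult (M : R) (f g : R -> R) : rep M f -> rep M g -> rep M (fun a => f a * g a).
Proof.
  intros (ts & V & H) (us & V' & H').
  exists (flat_map (fun t => map (tmul t) us) ts); split.
  - apply Forall_forall; intros v Hv.
    apply in_flat_map in Hv as (t & Ht & Hv); apply in_map_iff in Hv as (u & <- & Hu).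
    rewrite Forall_forall in V, V'; apply tmul_valid; auto.
  - intros a Ha; destruct (H a Ha) as [O E]; destruct (H' a Ha) as [O' E']; split.
    + apply Forall_forall; intros v Hv.
      apply in_flat_map in Hv as (t & Ht & Hv); apply in_map_iff in Hv as (u & <- & Hu).
      rewrite Forall_forall in O, O'; apply tmul_ok; auto.
    + rewrite E, E'; clear - O O'.
      assert (L : forall t, term_ok_at a t ->
                sumT a (map (tmul t) us) = term_eval a t * sumT a us).
      { intros t Ht; induction O' as [|u us Hu O' IH]; unfold sumT in *; simpl; [ring|].
        rewrite IH, tmul_eval by assumption; ring. }
      induction O as [|t ts Ht O IH]; [unfold sumT; simpl; ring|].
      simpl; rewrite sumT_app, <- IH, L by assumption; unfold sumT; simpl; ring.
Qed.

Lemma rep_single (M : R) (t : term) : term_valid t -> (forall a, a > M -> term_ok_at a t) ->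
  rep M (fun a => term_eval a t).
Proof.
  intros V H; exists (t :: nil); split; [auto|].
  intros a Ha; split; [auto|unfold sumT; simpl; ring].
Qed.

Lemma rep_Q (M : R) (q : Q) : rep M (fun _ => Q2R q).
Proof.
  apply (rep_ext M (fun a => term_eval a (mkTerm (q :: nil) (1%Q :: nil) nil nil))).
  - intros a _; unfold term_eval; simpl; rewrite RMicromega.Q2R_1; field.
  - apply rep_single; [split; constructor|].
    intros a _; split; [simpl; rewrite RMicromega.Q2R_1; lra|constructor].
Qed.

(** * Functions with closed forms at all admissible integer shifts *)

(** All shifts are included because F is evaluated both at a - j and at a - j + n. The bound on M
    makes a + t positive, away from zero denominators and from the poles of the harmonic numbers. *)
Definition closed_form (F : R -> R) : Prop :=
  forall (M : R) (t : Z), 0 <= M + IZR t -> rep M (fun a => F (a + IZR t)).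

Lemma cf_plus (F G : R -> R) : closed_form F -> closed_form G -> closed_form (fun x => F x + G x).
Proof.
  intros HF HG M t H.
  apply (rep_plus M (fun a => F (a + IZR t)) (fun a => G (a + IZR t))); auto.
Qed.

Lemma cf_mult (F G : R -> R) : closed_form F -> closed_form G -> closed_form (fun x => F x * G x).
Proof.
  intros HF HG M t H.
  apply (rep_mult M (fun a => F (a + IZR t)) (fun a => G (a + IZR t))); auto.
Qed.

Lemma cf_Q (q : Q) : closed_form (fun _ => Q2R q).
Proof. intros M t _; apply rep_Q. Qed.

Lemma cf_eq (F G : R -> R) : (forall x, F x = G x) -> closed_form F -> closed_form G.
Proof. intros E HF M t H; apply (rep_ext M _ _ (fun a _ => E (a + IZR t))); auto. Qed.

Lemma Q2R_inject_Z (z : Z) : Q2R (inject_Z z) = IZR z.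
Proof. unfold Q2R; simpl; field. Qed.

Lemma cf_IZR (z : Z) : closed_form (fun _ => IZR z).
Proof.
  apply (cf_eq (fun _ => Q2R (inject_Z z))); [|apply cf_Q].
  intros _; apply Q2R_inject_Z.
Qed.

Lemma cf_half : closed_form (fun _ => / 2).
Proof.
  apply (cf_eq (fun _ => Q2R (1 # 2))); [|apply cf_Q].
  intros _; unfold Q2R; simpl; field.
Qed.

Lemma cf_opp (F : R -> R) : closed_form F -> closed_form (fun x => - F x).
Proof.
  intros HF; apply (cf_eq (fun x => IZR (-1) * F x)); [intros x; ring|].
  apply cf_mult; [apply cf_IZR|exact HF].
Qed.

Lemma cf_minus (F G : R -> R) : closed_form F -> closed_form G -> closed_form (fun x => F x - G x).
Proof. intros HF HG; apply (cf_plus F (fun x => - G x)); [exact HF|now apply cf_opp]. Qed.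

Lemma cf_pow (F : R -> R) (n : nat) : closed_form F -> closed_form (fun x => F x ^ n).
Proof.
  intros HF; induction n as [|n IH]; simpl; [apply cf_IZR|now apply cf_mult].
Qed.

Lemma cf_inv : closed_form (fun x => / x).
Proof.
  intros M t H.
  apply (rep_ext M (fun a => term_eval a
    (* The denominator is the polynomial t + a, constant coefficient first. *)
    (mkTerm (1%Q :: nil) (inject_Z t :: 1%Q :: nil) nil nil))).
  - intros a Ha; unfold term_eval; simpl; rewrite Q2R_inject_Z, RMicromega.Q2R_1; field; lra.
  - apply rep_single; [split; constructor|].
    intros a Ha; split; [|constructor].
    simpl; rewrite Q2R_inject_Z, RMicromega.Q2R_1; lra.
Qed.

Lemma cf_div (F : R -> R) : closed_form F -> closed_form (fun x => F x / x).
Proof. intros HF; apply (cf_mult F (fun x => / x)); [exact HF|apply cf_inv]. Qed.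

Lemma cf_zeta (s : nat) : (2 <= s)%nat -> closed_form (fun _ => zeta s).
Proof.
  intros Hs M t _.
  apply (rep_ext M (fun a => term_eval a (mkTerm (1%Q :: nil) (1%Q :: nil) (s :: nil) nil))).
  - intros a _; unfold term_eval; simpl; rewrite RMicromega.Q2R_1; field.
  - apply rep_single; [split; repeat constructor; exact Hs|].
    intros a _; split; [simpl; rewrite RMicromega.Q2R_1; lra|constructor].
Qed.

Lemma cf_Hm (m : nat) : (1 <= m)%nat -> closed_form (Hm m).
Proof.
  intros hm M t H.
  apply (rep_ext M (fun a => term_eval a (mkTerm (1%Q :: nil) (1%Q :: nil) nil ((m, t) :: nil)))).
  - intros a _; unfold term_eval; simpl; rewrite RMicromega.Q2R_1; field.
  - apply rep_single; [split; repeat constructor; exact hm|].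
    intros a Ha; split; [simpl; rewrite RMicromega.Q2R_1; lra|].
    repeat constructor; intros n; assert (Hn := INR_S_pos n); cbn [snd]; lra.
Qed.

Lemma cf_hz (m : nat) : (2 <= m)%nat -> closed_form (hz m).
Proof.
  intros hm; apply (cf_minus (fun _ => zeta m) (Hm m)); [now apply cf_zeta|apply cf_Hm; lia].
Qed.

Lemma cf_TH (m : nat) : closed_form (TH m).
Proof.
  induction m as [|m IH]; [apply cf_div, cf_Hm; lia|].
  apply (cf_div (fun b => TH m b - hz (S (S m)) b)), cf_minus; [exact IH|apply cf_hz; lia].
Qed.

Ltac prove_cf :=
  repeat first
    [ apply cf_IZR | apply cf_half | apply cf_inv
    | apply cf_zeta; lia | apply cf_TH
    | apply (cf_Hm _); lia | apply (cf_hz _); lia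
    | apply cf_plus | apply cf_minus | apply cf_div | apply cf_mult
    | apply cf_opp | apply cf_pow ].

Lemma cf_TH1H2 : closed_form TH1H2.
Proof. unfold TH1H2, TH1hz2, sum_hz2, P2; prove_cf. Qed.

Lemma cf_TH1cube : closed_form TH1cube.
Proof. unfold TH1cube, TH1H2, TH1hz2, sum_hz2, P2, P3; prove_cf. Qed.

Lemma cf_TH1sqrH2 : closed_form TH1sqrH2.
Proof.
  unfold TH1sqrH2, TH1sqr_hz2, sum_H1_hz2, TH1hz2, sum_hz2, P2, P3; prove_cf.
Qed.

(** * Linear operations on representable series *)

(** Separates the closed form from the convergence, and trades [infinite_sum] for [is_series]. *)
Lemma representable_iff (M : R) (f : R -> nat -> R) :
  representable M f <->
  exists g, rep M g /\ forall a, a > M -> is_series (fun n => f a (S n)) (g a).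
Proof.
  split.
  - intros (ts & V & H); exists (fun a => sumT a ts); split.
    + exists ts; split; [exact V|]; intros a Ha; split; [apply H, Ha|reflexivity].
    + intros a Ha; apply is_series_Reals, H, Ha.
  - intros (g & (ts & V & H) & S); exists ts; split; [exact V|].
    intros a Ha; destruct (H a Ha) as [O E]; split; [exact O|].
    fold (sumT a ts); rewrite <- E; apply is_series_Reals, S, Ha.
Qed.

Lemma representable_plus (M : R) (f f' : R -> nat -> R) :
  representable M f -> representable M f' -> representable M (fun a n => f a n + f' a n).
Proof.
  intros (g & Hg & H)%representable_iff (g' & Hg' & H')%representable_iff.
  apply representable_iff; exists (fun a => g a + g' a); split; [now apply rep_plus|].
  intros a Ha; apply is_series_Rplus; auto.
Qed.

Lemma representable_scal (M : R) (q : Q) (f : R -> nat -> R) :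
  representable M f -> representable M (fun a n => Q2R q * f a n).
Proof.
  intros (g & Hg & H)%representable_iff.
  apply representable_iff; exists (fun a => Q2R q * g a); split.
  - apply (rep_mult M (fun _ => Q2R q)); [apply rep_Q|exact Hg].
  - intros a Ha; apply is_series_Rscal; auto.
Qed.

Lemma representable_ext (M : R) (f f' : R -> nat -> R) :
  (forall a n, a > M -> f a (S n) = f' a (S n)) -> representable M f -> representable M f'.
Proof.
  intros E (g & Hg & H)%representable_iff.
  apply representable_iff; exists g; split; [exact Hg|].
  intros a Ha; refine (is_series_ext _ _ _ _ (H a Ha)); auto.
Qed.

(** * From T_F to the denominators (n+r)(n+k) *)

Section Representable.
Variables F G : R -> R.
Hypotheses (HF : nonneg_incr F) (cfF : closed_form F) (cfG : closed_form G)
  (HT : forall b, 0 < b -> diff_series F b (G b)).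

(** Handles the initial terms dropped in passing to a tail: each is F at an integer shift of a,
    times a rational constant. *)
Lemma rep_partial_sum (M : R) (t : Z) (N : nat) : 0 <= M + IZR t ->
  rep M (fun a => sum_n (fun n => F (INR (S n) + (a + IZR t)) / (INR (S n) * INR (S (S n)))) N).
Proof.
  intros Ht.
  assert (L : forall n, rep M (fun a => F (INR (S n) + (a + IZR t)) / (INR (S n) * INR (S (S n))))).
  { intros n.
    assert (Hn := INR_S_pos n); assert (Hn' := INR_S_pos (S n)).
    apply (rep_ext M (fun a => F (a + IZR (Z.of_nat (S n) + t))
                               * Q2R (/ inject_Z (Z.of_nat (S n) * Z.of_nat (S (S n)))))).
    - intros a Ha.
      rewrite Q2R_inv, Q2R_inject_Z, mult_IZR, plus_IZR, <- !INR_IZR_INZ.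
      + replace (INR (S n) + (a + IZR t)) with (a + (INR (S n) + IZR t)) by ring; reflexivity.
      + intros E; unfold Qeq in E; cbn [inject_Z Qnum Qden] in E; lia.
    - apply (rep_mult M (fun a => F (a + IZR (Z.of_nat (S n) + t)))); [|apply rep_Q].
      apply cfF; rewrite plus_IZR, <- INR_IZR_INZ; lra. }
  induction N as [|N IH].
  - apply (rep_ext M _ _ (fun a _ => eq_sym (sum_O _)) (L 0%nat)).
  - apply (rep_ext M _ _ (fun a _ => eq_sym (sum_Sn_R _ N)) (rep_plus M _ _ IH (L (S N)))).
Qed.

(* With b = a - j, the sum over n >= 1 of F(n+a)/((n+j)(n+j+1)) is the tail from
   n' = j + 1 of the sum of F(n'+b)/(n'(n'+1)). *)
Lemma representable_consecutive (M : R) (j : nat) : (1 <= j)%nat -> INR j <= M ->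
  representable M (fun a n => F (INR n + a) / ((INR n + INR j) * (INR n + INR j + 1))).
Proof.
  intros Hj HM; set (t := (- Z.of_nat j)%Z).
  assert (Et : IZR t = - INR j) by (unfold t; rewrite opp_IZR, <- INR_IZR_INZ; reflexivity).
  assert (Ht : 0 <= M + IZR t) by lra.
  set (w a n := F (INR (S n) + (a + IZR t)) / (INR (S n) * INR (S (S n)))).
  apply representable_iff.
  (* [sum_n] includes its last index, so the j dropped terms are those up to [pred j]. *)
  exists (fun a => (F (a + IZR t) + G (a + IZR t)) + Q2R (-1) * sum_n (w a) (pred j)); split.
  - apply (rep_plus M (fun a => F (a + IZR t) + G (a + IZR t))).
    + apply rep_plus; auto.
    + apply (rep_mult M (fun _ => Q2R (-1))); [apply rep_Q|now apply rep_partial_sum].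
  - intros a Ha.
    assert (H := abel_series F (a + IZR t) HF ltac:(lra) _ (HT (a + IZR t) ltac:(lra))).
    apply (is_series_ext (fun n => w a (j + n)%nat)).
    + intros n; unfold w.
      replace (INR (S n) + INR j) with (INR (S (j + n))) by (rewrite <- plus_INR; f_equal; lia).
      rewrite <- (S_INR (S (j + n))).
      replace (INR (S (j + n)) + (a + IZR t)) with (INR (S n) + a); [reflexivity|].
      rewrite Et, !S_INR, plus_INR; ring.
    + apply is_series_incr_n; [lia|].
      refine (is_series_eq _ _ _ _ (fun n => eq_refl) _ H).
      change (@eq R (F (a + IZR t) + G (a + IZR t))
        (F (a + IZR t) + G (a + IZR t) + Q2R (-1) * sum_n (w a) (pred j) + sum_n (w a) (pred j))).
      change (-1)%Q with (inject_Z (-1)); rewrite Q2R_inject_Z; ring.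
Qed.

(** The gap from j to j + d is a sum of d consecutive gaps 1/(n+i) - 1/(n+i+1) =
    1/((n+i)(n+i+1)). *)
Lemma representable_gap (M : R) (j d : nat) : (1 <= j)%nat -> INR (j + d) <= M ->
  representable M (fun a n => F (INR n + a) * (/ (INR n + INR j) - / (INR n + INR (j + d)))).
Proof.
  intros Hj; induction d as [|d IH]; intros HM.
  (* For d = 0 the series is zero, written as 0 times a representable one. *)
  - apply (representable_ext M (fun a n => Q2R 0 * (F (INR n + a)
             / ((INR n + INR j) * (INR n + INR j + 1))))).
    + intros a n _; rewrite Nat.add_0_r, RMicromega.Q2R_0; ring.
    + apply representable_scal, representable_consecutive; [exact Hj|].
      now rewrite Nat.add_0_r in HM.
  - assert (HM' : INR (j + d) <= M) by (rewrite Nat.add_succ_r, S_INR in HM; lra).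
    refine (representable_ext M _ _ _ (representable_plus M _ _ (IH HM')
              (representable_consecutive M (j + d) _ HM'))); [|lia].
    intros a n _; assert (Hn := INR_S_pos n); assert (Hjd := pos_INR (j + d)); assert (Hj' := pos_INR j).
    rewrite Nat.add_succ_r, (S_INR (j + d)); field; lra.
Qed.

(** Partial fractions: the product is the gap from j to k divided by k - j. *)
Lemma representable_lt (j k : nat) : (1 <= j)%nat -> (j < k)%nat -> forall M, INR k <= M ->
  representable M (fun a n => F (INR n + a) / ((INR n + INR j) * (INR n + INR k))).
Proof.
  intros Hj Hjk M HM.
  assert (Hd : INR k = INR j + INR (k - j)) by (rewrite <- plus_INR; f_equal; lia).
  assert (Hp : 0 < INR (k - j)) by (apply lt_0_INR; lia).
  refine (representable_ext M _ _ _ (representable_scal M (/ inject_Z (Z.of_nat (k - j))) _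
            (representable_gap M j (k - j) Hj _))).
  - intros a n _; assert (Hn := INR_S_pos n); assert (Hj' := pos_INR j).
    rewrite Q2R_inv, Q2R_inject_Z, <- INR_IZR_INZ, plus_INR, Hd.
    + field; lra.
    + intros E; unfold Qeq in E; cbn [inject_Z Qnum Qden] in E; lia.
  - rewrite plus_INR, <- Hd; exact HM.
Qed.

Lemma representable_neq (r k : nat) : (1 <= r)%nat -> (1 <= k)%nat -> k <> r ->
  representable (INR (Nat.max k r))
    (fun a n => F (INR n + a) / ((INR n + INR r) * (INR n + INR k))).
Proof.
  intros Hr Hk Hkr; destruct (Nat.lt_total r k) as [H|[H|H]]; [|congruence|].
  - apply representable_lt; [exact Hr|exact H|apply le_INR; lia].
  - refine (representable_ext _ _ _ _ (representable_lt k r Hk H _ (le_INR _ _ (Nat.le_max_r k r)))).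
    intros a n _; rewrite (Rmult_comm (INR (S n) + INR k)); reflexivity.
Qed.
End Representable.

Theorem theorem2p9 (k r m : nat) (hk : (1 <= k)%nat) (hr : (1 <= r)%nat)
  (hm : (1 <= m)%nat) (hkr : k <> r) :
  let M := INR (Nat.max k r) in
  let D := fun (a : R) (n : nat) => (INR n + INR r) * (INR n + INR k) in
  representable M (fun a n => Hm m (INR n + a) / D a n) /\
  representable M (fun a n => Hm 1 (INR n + a) * Hm 2 (INR n + a) / D a n) /\
  representable M (fun a n => Hm 1 (INR n + a) ^ 3 / D a n) /\
  representable M (fun a n => Hm 1 (INR n + a) ^ 2 * Hm 2 (INR n + a) / D a n).
Proof.
  intros M D.
  assert (Hincr : forall i, nonneg_incr (Hm (S i))) by (intros; apply nonneg_incr_Hm; lia).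
  assert (Hcf : forall i, closed_form (Hm (S i))) by (intros; apply cf_Hm; lia).
  repeat split.
  - destruct m as [|m']; [lia|].
    apply (representable_neq (Hm (S m')) (TH m')); auto using cf_TH.
    intros; now apply diff_series_Hm.
  - apply (representable_neq (fun x => Hm 1 x * Hm 2 x) TH1H2);
      auto using cf_mult, nonneg_incr_mult, cf_TH1H2, diff_series_H1_H2.
  - apply (representable_neq (fun x => Hm 1 x ^ 3) TH1cube);
      auto using cf_pow, nonneg_incr_pow, cf_TH1cube, diff_series_H1_cube.
  - apply (representable_neq (fun x => Hm 1 x ^ 2 * Hm 2 x) TH1sqrH2);
      auto using cf_mult, cf_pow, nonneg_incr_mult, nonneg_incr_pow, cf_TH1sqrH2, diff_series_H1_sqr_H2.
Qed.
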